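(* Suppose $(X_t)_{t>0}$ is a quadratic harness with parameters $q,\eta,\theta,\sigma,\tau$ such that $(1-\sigma\tau)^2+(\eta+\theta\sigma)(\theta+\eta\tau)>0$, $0\le\sigma\tau<1$, and $q=-\sigma\tau$. If for each $t>0$ the random variable $X_t$ has all moments and infinite support, then $(X_t)$ has orthogonal martingale polynomials given by the three step recurrences $$x\,p_0(x;t)=p_1(x;t),\qquad p_0(x;t)=1,$$ $$x\,p_1(x;t)=(1+\sigma t)p_2(x;t)+\frac{(\eta+\theta\sigma)t+(\eta\tau+\theta)}{1-\sigma\tau}p_1(x;t)+t\,p_0(x;t),$$ $$x\,p_2(x;t)=(1+\sigma t)p_3(x;t)+\frac{(\eta+2\theta\sigma+\eta\sigma\tau)t+\theta+2\eta\tau+\theta\sigma\tau}{(1-\sigma\tau)^2}p_2(x;t)+\frac{(1-\sigma\tau)^2+(\eta+\theta\sigma)(\theta+\eta\tau)}{(1-\sigma\tau)^3}(t+\tau)p_1(x;t),$$ and for $n\ge3$ $$x\,p_n(x;t)=(1+\sigma t)p_{n+1}(x;t)+\frac{(\eta+2\theta\sigma+\eta\sigma\tau)t+\theta+2\eta\tau+\theta\sigma\tau}{(1-\sigma\tau)^2}p_n(x;t)+\frac{(1-\sigma\tau)^2+(\eta+\theta\sigma)(\theta+\eta\tau)}{(1-\sigma\tau)^4}(t+\tau)p_{n-1}(x;t).$$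
   Context: Equalities between conditional expectations hold almost surely. $(X_t)_{t>0}$ is a separable square-integrable real process; $\mathcal F_{s,u}=\sigma\{X_t:t\in(0,s]\cup[u,\infty)\}$, $\mathcal F_{\le s}=\sigma\{X_t:0<t\le s\}$; $\mathrm{Var}[X\mid\mathcal F]=\mathbb{E}[X^2\mid\mathcal F]-(\mathbb{E}[X\mid\mathcal F])^2$; $\Delta_{s,u}=\frac{X_u-X_s}{u-s}$, $\widetilde\Delta_{s,u}=\frac{uX_s-sX_u}{u-s}$. For real $q,\eta,\theta$ and $\sigma,\tau\ge0$, $(X_t)$ is a quadratic harness with parameters $q,\eta,\theta,\sigma,\tau$ if $\mathbb{E}(X_t)=0$, $\mathbb{E}(X_sX_t)=\min\{s,t\}$ for all $s,t>0$, and for all $0<s<t<u$ $$\mathbb{E}[X_t\mid\mathcal F_{s,u}]=\tfrac{u-t}{u-s}X_s+\tfrac{t-s}{u-s}X_u,$$ $$\mathrm{Var}[X_t\mid\mathcal F_{s,u}]=\tfrac{(u-t)(t-s)}{u(1+\sigma s)+\tau-qs}\Big(1+\eta\widetilde\Delta_{s,u}+\theta\Delta_{s,u}+\sigma\widetilde\Delta_{s,u}^2+\tau\Delta_{s,u}^2-(1-q)\Delta_{s,u}\widetilde\Delta_{s,u}\Big).$$ Orthogonal martingale polynomials for $(X_t)$: polynomials $p_n(x;t)$ in $x$ of degree $n$ with $\mathbb{E}[p_n(X_t;t)\mid\mathcal F_{\le s}]=p_n(X_s;s)$ for all $0<s<t$, $n\ge0$, and $\mathbb{E}(p_n(X_t;t)p_m(X_t;t))=0$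 for all $t>0$, $n\ne m$. ''Infinite support'' means the support of the law of $X_t$ is an infinite set. *)

(* Defs.v *)
From HB Require Import structures.
From mathcomp Require Export all_boot all_order all_algebra.
From mathcomp Require Export all_classical all_reals all_analysis.
Set Implicit Arguments.
Unset Strict Implicit.
Unset Printing Implicit Defensive.
Import Order.TTheory GRing.Theory Num.Theory.
Import numFieldNormedType.Exports.
Local Open Scope classical_set_scope.
Local Open Scope ring_scope.

(* A process (X_t)_(t > 0) is a family X : R -> {RV P >-> R}; nothing below
   depends on the values X t for t <= 0. *)
Section Process.
Context {d : measure_display} {T : measurableType d} {R : realType}.
Variable P : probability T R.
Implicit Types (F : set_system T) (Y Z : T -> R) (X : R -> {RV P >-> R}).

(* Y is a version of E[Z | F]; F is meant to be a sub-sigma-algebra. *)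
Record is_condexp F Z Y : Prop := IsCondexp {
  condexp_measurable : forall B : set R, measurable B -> F (Y @^-1` B) ;
  condexp_integrable_arg : P.-integrable [set: T] (EFin \o Z) ;
  condexp_integrable : P.-integrable [set: T] (EFin \o Y) ;
  condexp_integral : forall A : set T, F A ->
    (\int[P]_(w in A) (Y w)%:E = \int[P]_(w in A) (Z w)%:E)%E }.

(* E[Z | F] = Y almost surely *)
Definition condexp_eq F Z Y : Prop :=
  exists M : T -> R, is_condexp F Z M /\ {ae P, forall w, M w = Y w}.

(* Var[Z | F] = E[Z^2 | F] - (E[Z | F])^2 = Y almost surely *)
Definition condvar_eq F Z Y : Prop :=
  exists M M2 : T -> R,
    [/\ is_condexp F Z M,
        is_condexp F (fun w => Z w ^+ 2) M2
      & {ae P, forall w, M2 w - M w ^+ 2 = Y w}].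

Definition sigma_process X (I : set R) : set_system T :=
  <<s \bigcup_(t in I) preimage_set_system [set: T] (X t) measurable >>.

Definition two_sided_filtration X (s u : R) : set_system T :=
  sigma_process X [set t | 0 < t <= s \/ u <= t].

Definition past_filtration X (s : R) : set_system T :=
  sigma_process X [set t | 0 < t <= s].

(* Separability with respect to closed sets; taking K = set0 shows that the
   countable set D is automatically dense in (0, +oo). *)
Definition separable_process X : Prop :=
  exists D : set R,
    [/\ countable D, D `<=` [set t | 0 < t]
      & {ae P, forall w, forall U K : set R, open U -> closed K ->
          (forall t, D t -> U t -> K (X t w)) ->
          forall t, 0 < t -> U t -> K (X t w)}].

Definition square_integrable_process X : Prop :=
  forall t, 0 < t -> P.-integrable [set: T] (fun w => (X t w ^+ 2)%:E).

Definition Delta X (s u : R) (w : T) : R := (X u w - X s w) / (u - s).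

Definition tDelta X (s u : R) (w : T) : R :=
  (u * X s w - s * X u w) / (u - s).

Record quadratic_harness X (q eta theta sigma tau : R) : Prop :=
  QuadraticHarness {
  qh_sigma_ge0 : 0 <= sigma ;
  qh_tau_ge0 : 0 <= tau ;
  qh_mean : forall t, 0 < t -> ('E_P[X t] = 0)%E ;
  qh_cov : forall s t, 0 < s -> 0 < t ->
    ('E_P[fun w => (X s w * X t w)%R] = (Num.min s t)%:E)%E ;
  qh_condexp : forall s t u, 0 < s -> s < t -> t < u ->
    condexp_eq (two_sided_filtration X s u) (X t)
      (fun w => (u - t) / (u - s) * X s w + (t - s) / (u - s) * X u w) ;
  qh_condvar : forall s t u, 0 < s -> s < t -> t < u ->
    condvar_eq (two_sided_filtration X s u) (X t)
      (fun w =>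
        ((u - t) * (t - s)) / (u * (1 + sigma * s) + tau - q * s) *
        (1 + eta * tDelta X s u w + theta * Delta X s u w
           + sigma * tDelta X s u w ^+ 2 + tau * Delta X s u w ^+ 2
           - (1 - q) * Delta X s u w * tDelta X s u w)) }.

(* p n t is the polynomial p_n(x; t) in the variable x. *)
Record orthogonal_martingale_polynomials X (p : nat -> R -> {poly R}) : Prop :=
  OrthogonalMartingalePolynomials {
  omp_degree : forall n t, 0 < t -> size (p n t) = n.+1 ;
  omp_martingale : forall n s t, 0 < s -> s < t ->
    condexp_eq (past_filtration X s)
      (fun w => (p n t).[X t w]) (fun w => (p n s).[X s w]) ;
  omp_orthogonal : forall n m t, 0 < t -> n <> m ->
    ('E_P[fun w => ((p n t).[X t w] * (p m t).[X t w])%R] = 0)%E }.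

Definition all_moments (Y : {RV P >-> R}) : Prop :=
  forall n : nat, P.-integrable [set: T] (fun w => (Y w ^+ n)%:E).

Definition law_support (Y : {RV P >-> R}) : set R :=
  [set x | forall U : set R, open U -> U x -> (0 < distribution P Y U)%E].

End Process.

(* Main.v *)
Require Import Defs.
From mathcomp Require Import measurable_realfun ring lra.
Import Order.TTheory GRing.Theory Num.Theory.
Import numFieldNormedType.Exports.
Local Open Scope classical_set_scope.
Local Open Scope ring_scope.
Set Implicit Arguments.
Unset Strict Implicit.
Unset Printing Implicit Defensive.

(* Write the recurrence as x p_n(x;t) = sum_j p_j(x;t) (x + t y)_(j, n) with
   two tridiagonal matrices x, y free of t.  They satisfy the q-commutation
   relation  y x = 1 + eta x + theta y + sigma x^2 + tau y^2 + q x y.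
   The martingale property is proved by induction on the degree.  Fix s < t < u,
   V measurable with respect to the past of s, and let d(r) be the difference
   between E[p_(k+2)(X_r;r) V] and E[p_(k+2)(X_s;s) V].  Testing the linear
   regression on p_(k+1)(X_u;u) V and the conditional variance on p_k(X_u;u) V
   turns everything except d into identities (the second one by
   q-commutation), leaving two linear homogeneous equations in d(t), d(u) whose
   determinant is nonzero.  Degree 1 follows by letting u go to infinity.
   The polynomials of positive degree have mean zero: otherwise E[X_s p_n(X_s;s)]
   would stay away from 0 as s -> 0, whereas it equals E[X_s p_n(X_t;t)].
   Orthogonality then follows from the recurrence. *)

(** * Measurability with respect to a generated sub-sigma-algebra *)

Definition smeasurable {T : Type} {R : realType} (F : set_system T)
    (W : T -> R) : Prop :=
  forall B : set R, measurable B -> F (W @^-1` B).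

Section SubSigmaAlgebra.
Context {d : measure_display} {T : measurableType d} {R : realType}.
Variable G : set_system T.
Let T' := g_sigma_algebraType G.

Lemma smeasurableP (W : T -> R) :
  smeasurable <<s G>> W <-> measurable_fun [set: T'] (W : T' -> R).
Proof.
split=> [mW _ B mB|mW B mB]; first by rewrite setTI; exact: mW.
by rewrite -[_ @^-1` _]setTI; exact: mW.
Qed.

Lemma smeasurable_cst (c : R) : smeasurable <<s G>> (fun=> c : R).
Proof. by apply/smeasurableP; exact: measurable_cst. Qed.

Lemma smeasurableM (V W : T -> R) : smeasurable <<s G>> V ->
  smeasurable <<s G>> W -> smeasurable <<s G>> (fun w => V w * W w).
Proof.
by move=> /smeasurableP mV /smeasurableP mW; exact/smeasurableP/measurable_funM.
Qed.

Lemma smeasurableD (V W : T -> R) : smeasurable <<s G>> V ->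
  smeasurable <<s G>> W -> smeasurable <<s G>> (fun w => V w + W w).
Proof.
by move=> /smeasurableP mV /smeasurableP mW; exact/smeasurableP/measurable_funD.
Qed.

Lemma smeasurable_indic (A : set T) : <<s G>> A -> smeasurable <<s G>> (\1_A : T -> R).
Proof.
by move=> GA; apply/smeasurableP; exact: (@measurable_indic _ T' R setT A).
Qed.

Lemma smeasurable_horner (V : T -> R) (p : {poly R}) : smeasurable <<s G>> V ->
  smeasurable <<s G>> (fun w => p.[V w]).
Proof.
move=> mV; elim/poly_ind: p => [|p c IH].
  by under eq_fun do rewrite horner0; exact: smeasurable_cst.
under eq_fun do rewrite hornerMXaddC.
by apply: smeasurableD; [exact: smeasurableM|exact: smeasurable_cst].
Qed.

Lemma smeasurable_measurable (W : T -> R) : G `<=` measurable ->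
  smeasurable <<s G>> W -> measurable_fun setT W.
Proof.
move=> Gm mW _ B mB; rewrite setTI.
by apply: (smallest_sub (@sigma_algebra_measurable _ _) Gm); exact: mW.
Qed.

End SubSigmaAlgebra.

(** * Random variables with all moments and their real-valued expectation *)

Section Expectation.
Context {d : measure_display} {T : measurableType d} {R : realType}.
Variable P : probability T R.
Implicit Types (f g W Y Z : T -> R) (G : set_system T).

(** Unlike integrability, this class is closed under products, so integrability of polynomials in
    the process follows by closure. *)
Definition finite_moments f : Prop := measurable_fun [set: T] f /\
  forall n : nat, P.-integrable [set: T] (fun w => (`|f w| ^+ n)%:E).

Lemma finite_moments_integrable f : finite_moments f ->
  P.-integrable setT (EFin \o f).
Proof.
move=> [mf /(_ 1%N) If]; apply: le_integrable If => //;
  first exact/measurable_EFinP.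
by move=> w _ /=; rewrite lee_fin expr1 normr_id.
Qed.

(** The dominating function may depend on the exponent: for a product, the [n]-th power is
    controlled by powers of order [2n] of the factors. *)
Lemma finite_moments_le f (g : nat -> T -> R) : measurable_fun setT f ->
  (forall n, P.-integrable setT (EFin \o g n)) ->
  (forall n w, `|f w| ^+ n <= `|g n w|) -> finite_moments f.
Proof.
move=> mf Ig fg; split=> // n; apply: le_integrable (Ig n) => //.
  by apply/measurable_EFinP; apply: measurable_funX; exact: measurableT_comp.
by move=> w _ /=; rewrite lee_fin ger0_norm// exprn_ge0.
Qed.

Lemma finite_moments_cst (c : R) : finite_moments (fun=> c).
Proof.
split=> [|n]; first exact: measurable_cst.
exact: finite_measure_integrable_cst.
Qed.

Lemma finite_momentsM f g : finite_moments f -> finite_moments g ->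
  finite_moments (fun w => f w * g w).
Proof.
move=> [mf If] [mg Ig].
apply: (@finite_moments_le _ (fun n w => `|f w| ^+ (n + n) + `|g w| ^+ (n + n))).
- exact: measurable_funM.
- by move=> n; exact: integrableD (If (n + n)%N) (Ig (n + n)%N).
- move=> n w; rewrite normrM exprMn !exprD.
  set a := `|f w| ^+ n; set b := `|g w| ^+ n.
  have a0 : 0 <= a by exact: exprn_ge0.
  have b0 : 0 <= b by exact: exprn_ge0.
  by rewrite ger0_norm; nra.
Qed.

Lemma finite_momentsD f g : finite_moments f -> finite_moments g ->
  finite_moments (fun w => f w + g w).
Proof.
move=> [mf If] [mg Ig].
apply: (@finite_moments_le _ (fun n w => 2 ^+ n * (`|f w| ^+ n + `|g w| ^+ n))).
- exact: measurable_funD.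
- move=> n; have := integrableZl measurableT (2 ^+ n)
    (integrableD measurableT (If n) (Ig n)).
  exact: eq_integrable.
- move=> n w; rewrite [leRHS]ger0_norm; last first.
    by rewrite mulr_ge0 ?addr_ge0 ?exprn_ge0.
  rewrite mulrDr -!exprMn.
  have a0 : 0 <= `|f w| by []; have b0 : 0 <= `|g w| by [].
  have ab := ler_normD (f w) (g w).
  have [le|/ltW le] := leP `|f w| `|g w|.
    apply: ler_wpDl; first by rewrite exprn_ge0 ?mulr_ge0.
    by rewrite lerXn2r ?nnegrE ?mulr_ge0//; lra.
  apply: ler_wpDr; first by rewrite exprn_ge0 ?mulr_ge0.
  by rewrite lerXn2r ?nnegrE ?mulr_ge0//; lra.
Qed.

Lemma finite_momentsZ (c : R) f : finite_moments f ->
  finite_moments (fun w => c * f w).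
Proof. by move=> mf; apply: finite_momentsM => //; exact: finite_moments_cst. Qed.

Lemma finite_moments_horner f (p : {poly R}) :
  finite_moments f -> finite_moments (fun w => p.[f w]).
Proof.
move=> mf; elim/poly_ind: p => [|p c IH].
  by under eq_fun do rewrite horner0; exact: finite_moments_cst.
under eq_fun do rewrite hornerMXaddC.
by apply: finite_momentsD; [exact: finite_momentsM|exact: finite_moments_cst].
Qed.

Lemma finite_moments_indic A : measurable A -> finite_moments (\1_A : T -> R).
Proof.
move=> mA; apply: (@finite_moments_le _ (fun=> fun=> 1)) => //.
  by move=> _; exact: finite_measure_integrable_cst.
move=> n w; rewrite normr1 exprn_ile1// ger0_norm// indicE.
Qed.

Definition ex f : R := \int[P]_w f w.

Lemma EFin_ex f : P.-integrable setT (EFin \o f) ->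
  (ex f)%:E = (\int[P]_w (f w)%:E)%E.
Proof. by move=> If; rewrite /ex /Rintegral fineK//; exact: integrable_fin_num. Qed.

Lemma exD f g : finite_moments f -> finite_moments g ->
  ex (fun w => f w + g w) = ex f + ex g.
Proof.
by move=> mf mg; rewrite /ex RintegralD//; exact: finite_moments_integrable.
Qed.

Lemma exZ (c : R) f : finite_moments f -> ex (fun w => c * f w) = c * ex f.
Proof.
by move=> mf; rewrite /ex RintegralZl//; exact: finite_moments_integrable.
Qed.

Lemma eq_ex f g : f =1 g -> ex f = ex g.
Proof. by move=> fg; congr ex; exact/funext. Qed.

Lemma ex_ge0 f : (forall w, 0 <= f w) -> 0 <= ex f.
Proof. by move=> f0; exact: Rintegral_ge0. Qed.

Lemma ex_cst (c : R) : ex (fun=> c) = c.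
Proof.
by rewrite /ex Rintegral_cst// (_ : fine _ = 1) ?mulr1// [X in fine X]probability_setT.
Qed.

Lemma integral_indic_ex A f : measurable A -> finite_moments f ->
  (\int[P]_(w in A) (f w)%:E)%E = (ex (fun w => \1_A w * f w))%:E.
Proof.
move=> mA mf; rewrite EFin_ex; last first.
  by apply: finite_moments_integrable; apply: finite_momentsM => //;
    exact: finite_moments_indic.
rewrite integral_mkcond; apply: eq_integral => w _.
by rewrite patchE indicE; case: ifP => _; rewrite ?mul1r ?mul0r.
Qed.

(** The second moment of [a f + b g] is a nonnegative quadratic form in [(a, b)]; at [(C, -A)] it
    equals [A (A B - C^2)], which settles the case [A > 0]. *)
Lemma ex_CauchySchwarz f g : finite_moments f -> finite_moments g ->
  ex (fun w => f w * g w) ^+ 2 <= ex (fun w => f w ^+ 2) * ex (fun w => g w ^+ 2).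
Proof.
move=> mf mg.
have mff : finite_moments (fun w => f w ^+ 2) by exact: finite_momentsM.
have mgg : finite_moments (fun w => g w ^+ 2) by exact: finite_momentsM.
have mfg : finite_moments (fun w => f w * g w) by exact: finite_momentsM.
set A := ex (fun w => f w ^+ 2); set B := ex (fun w => g w ^+ 2).
set C := ex (fun w => f w * g w).
have H (a b : R) : 0 <= a ^+ 2 * A + (2 * a * b) * C + b ^+ 2 * B.
  have <- : ex (fun w => (a * f w + b * g w) ^+ 2) =
            a ^+ 2 * A + (2 * a * b) * C + b ^+ 2 * B.
    rewrite -!exZ// -!exD//;
      try
      by repeat (apply: finite_momentsM || apply: finite_momentsD || exact: finite_moments_cst).
    by apply: eq_ex => w; ring.
  by apply: ex_ge0 => w; exact: sqr_ge0.
have A0 : 0 <= A by apply: ex_ge0 => w; exact: sqr_ge0.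
have [A00|A00] := eqVneq A 0.
  rewrite A00 mul0r; have [->|C0] := eqVneq C 0; first by rewrite expr0n.
  (* With [A = 0] and [C] nonzero, this point gives the form the value [-1]. *)
  have := H (- (B + 1) / (2 * C)) 1.
  have -> : 2 * (- (B + 1) / (2 * C)) * 1 * C = - (B + 1) by field.
  by rewrite A00 mulr0 add0r expr1n mul1r; lra.
have {}A0 : 0 < A by rewrite lt_neqAle eq_sym A00.
have := H C (- A).
have -> : C ^+ 2 * A + 2 * C * - A * C + (- A) ^+ 2 * B = A * (A * B - C ^+ 2).
  by ring.
by rewrite pmulr_rge0// subr_ge0.
Qed.

Definition null_ex f : Prop := P.-integrable setT (EFin \o f) /\ ex f = 0.

Lemma null_exD f g : null_ex f -> null_ex g -> null_ex (fun w => f w + g w).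
Proof.
move=> [If f0] [Ig g0]; split;
  last by rewrite /ex RintegralD// [X in X + _]f0 add0r.
exact: (integrableD measurableT If Ig).
Qed.

Lemma null_exZ (c : R) f : null_ex f -> null_ex (fun w => c * f w).
Proof.
move=> [If f0]; split; last by rewrite /ex RintegralZl// [X in _ * X]f0 mulr0.
exact: (integrableZl measurableT c If).
Qed.

Lemma integrable_indicM A f : measurable A -> P.-integrable setT (EFin \o f) ->
  P.-integrable setT (EFin \o (fun w => \1_A w * f w)).
Proof.
move=> mA If; apply: le_integrable (If) => //.
  apply/measurable_EFinP/measurable_funM; first exact: measurable_indic.
  by apply/measurable_EFinP; exact: measurable_int If.
move=> w _ /=; rewrite lee_fin normrM indicE.
by case: (_ \in _); rewrite ?normr1 ?normr0 ?mul1r ?mul0r.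
Qed.

(** * The pull-out property of conditional expectation *)

Section PullOut.
Import HBNNSimple.
Variable G : set_system T.
Hypothesis Gm : G `<=` measurable.
Let T' := g_sigma_algebraType G.
Variable g : T -> R.
Hypothesis Ig : P.-integrable setT (EFin \o g).
Hypothesis g0 : forall A, <<s G>> A -> ex (fun w => \1_A w * g w) = 0.

Let GTm A : <<s G>> A -> measurable A.
Proof. by apply: (smallest_sub (@sigma_algebra_measurable _ _) Gm). Qed.

Let pull_out_nnsfun (h : {nnsfun T' >-> R}) : null_ex (fun w => h w * g w).
Proof.
have -> : (fun w => h w * g w) = (fun w =>
    \sum_(y <- finmap.enum_fset (fset_set (range h))) y * (\1_(h @^-1` [set y]) w * g w)).
  apply/funext => w; rewrite {1}(fimfunE h w) fsbig_finite//= mulr_suml.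
  by apply: eq_bigr => y _; rewrite mulrA.
elim: (finmap.enum_fset _) => [|y s IH].
  under eq_fun do rewrite big_nil.
  by split; [exact: integrable0|rewrite ex_cst].
under eq_fun do rewrite big_cons.
apply: null_exD => //; apply: null_exZ.
have hy : <<s G>> (h @^-1` [set y]) by apply: (@measurable_funPTI _ _ T' _ h).
by split; [apply: integrable_indicM => //; exact: GTm|exact: g0].
Qed.

(** Dominated convergence along simple functions increasing to [W], with [|W g|] as the dominating
    function. *)
Let pull_out_ge0 W : (forall w, 0 <= W w) -> smeasurable <<s G>> W ->
  P.-integrable setT (EFin \o (fun w => W w * g w)) -> ex (fun w => W w * g w) = 0.
Proof.
move=> W0 mW IWg.
have mW' : measurable_fun [set: T'] (EFin \o (W : T' -> R)).
  exact/measurable_EFinP/smeasurableP.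
(* The approximation takes place on [T'], so each [h n] is measurable for the sub-sigma-algebra. *)
pose h n := nnsfun_approx measurableT mW' n.
have hW n w : h n w <= W w.
  rewrite /h nnsfun_approxE -lee_fin.
  by apply: (@le_approx _ T' R setT (EFin \o W) n w) => // x _; rewrite lee_fin.
have mg : measurable_fun setT g by apply/measurable_EFinP; exact: measurable_int Ig.
have := @dominated_cvg _ T R P setT measurableT
  (fun n w => (h n w * g w)%:E) (fun w => (W w * g w)%:E)
  (fun w => `|(W w * g w)%:E|%E).
move=> /(_ _ _ _ _ _) H.
have {}H : (\int[P]_w (h n w * g w)%:E)%E @[n --> \oo] --> (\int[P]_w (W w * g w)%:E)%E.
  apply: H => //.
  - move=> n; apply/measurable_EFinP; apply: measurable_funM => //.
    apply: (smeasurable_measurable Gm); apply/smeasurableP.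
    exact: (@measurable_funPT _ _ T' _ (h n)).
  - move=> w _; under eq_fun do rewrite EFinM.
    rewrite EFinM; apply: cvgeZr => //.
    by apply: (@cvg_nnsfun_approx _ T' R setT measurableT _ mW') => // x _;
      rewrite lee_fin.
  - exact: (integrable_abse IWg).
  - move=> n w _; rewrite /= lee_fin !normrM ler_wpM2r// ger0_norm// ger0_norm//.
move: H; rewrite (_ : (fun n => _) = cst 0%E); last first.
  apply/funext => n; have [I0 E0] := pull_out_nnsfun (h n).
  by rewrite -EFin_ex// E0.
move=> /(cvg_lim (@ereal_hausdorff R)); rewrite lim_cst// -EFin_ex// => H.
by apply: EFin_inj; rewrite -H.
Qed.

(** [W] splits into its positive and negative parts; both are at most [|W|], so their products with
    [g] stay integrable. *)
Lemma pull_out W : smeasurable <<s G>> W ->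
  P.-integrable setT (EFin \o (fun w => W w * g w)) ->
  ex (fun w => W w * g w) = 0.
Proof.
move=> mW IWg.
have mg : measurable_fun setT g by apply/measurable_EFinP; exact: measurable_int Ig.
have Hpart (V : T -> R) : (forall w, 0 <= V w <= `|W w|) -> smeasurable <<s G>> V ->
    P.-integrable setT (EFin \o (fun w => V w * g w)) /\
    ex (fun w => V w * g w) = 0.
  move=> V0 mV; suff IV : P.-integrable setT (EFin \o (fun w => V w * g w)).
    by split=> //; apply: pull_out_ge0 => // w; case/andP: (V0 w).
  apply: le_integrable (IWg) => //.
    apply/measurable_EFinP/measurable_funM => //; exact: smeasurable_measurable mV.
  move=> w _ /=; rewrite lee_fin !normrM ler_wpM2r//.
  by case/andP: (V0 w) => V00 VW; rewrite ger0_norm.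
have [Ip p0] : P.-integrable setT (EFin \o (fun w => W^\+ w * g w)) /\
    ex (fun w => W^\+ w * g w) = 0.
  apply: Hpart => [w|].
    rewrite funrpos_ge0/=; have /(congr1 (fun f => f w)) /= <- := funrposDneg W.
    by rewrite lerDl funrneg_ge0.
  by apply/smeasurableP; apply: measurable_funrpos; exact/smeasurableP.
have [In n0] : P.-integrable setT (EFin \o (fun w => W^\- w * g w)) /\
    ex (fun w => W^\- w * g w) = 0.
  apply: Hpart => [w|].
    rewrite funrneg_ge0/=; have /(congr1 (fun f => f w)) /= <- := funrposDneg W.
    by rewrite lerDr funrpos_ge0.
  by apply/smeasurableP; apply: measurable_funrneg; exact/smeasurableP.
rewrite -[RHS](subr0 0) -[X in _ = X - _]p0 -[X in _ = _ - X]n0.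
rewrite /ex -RintegralB//; apply: eq_ex => w.
by rewrite -mulrBl -[in LHS](funrposBneg W).
Qed.

End PullOut.

(** Uniqueness of conditional expectations: testing the difference [h] on its own sign shows that
    [|h|] has zero expectation. *)
Lemma smeasurable_ae_eq G f g : G `<=` measurable ->
  smeasurable <<s G>> f -> smeasurable <<s G>> g ->
  P.-integrable setT (EFin \o f) -> P.-integrable setT (EFin \o g) ->
  (forall A, <<s G>> A ->
    (\int[P]_(w in A) (f w)%:E = \int[P]_(w in A) (g w)%:E)%E) ->
  {ae P, forall w, f w = g w}.
Proof.
move=> Gm mf mg If Ig fg.
pose h w := f w + -1 * g w.
have Ih : P.-integrable setT (EFin \o h).
  exact: (integrableD measurableT If (integrableZl measurableT (-1) Ig)).
have mh : smeasurable <<s G>> h.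
  by apply: smeasurableD => //; apply: smeasurableM => //; exact: smeasurable_cst.
have h0 A : <<s G>> A -> ex (fun w => \1_A w * h w) = 0.
  move=> GA; have mA : measurable A.
    by apply: (smallest_sub (@sigma_algebra_measurable _ _) Gm) GA.
  have mkint k : P.-integrable setT (EFin \o k) ->
      (\int[P]_(w in A) (k w)%:E)%E = (ex (fun w => \1_A w * k w))%:E.
    move=> Ik; rewrite EFin_ex; last exact: integrable_indicM.
    rewrite integral_mkcond; apply: eq_integral => w _.
    by rewrite patchE indicE; case: ifP => _; rewrite ?mul1r ?mul0r.
  have := fg _ GA; rewrite !mkint// => -[fgA].
  transitivity (ex (fun w => \1_A w * f w - \1_A w * g w)).
    by apply: eq_ex => w; rewrite /h; ring.
  by rewrite /ex RintegralB//; [apply/eqP; rewrite subr_eq0; exact/eqP| |];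
    exact: integrable_indicM.
(* The sign of [h], with the value 1 where [h] vanishes. *)
pose W w : R := \1_[set w | 0 <= h w] w + -1 * \1_[set w | h w < 0] w.
have WhE w : W w * h w = `|h w|.
  rewrite /W !indicE; have [h0w|h0w] := lerP 0 (h w).
    rewrite mem_set// memNset /=; last by apply/negP; rewrite -leNgt.
    by rewrite mulr0 addr0 mul1r ger0_norm.
  rewrite memNset /=; last by apply/negP; rewrite -ltNge.
  by rewrite mem_set// add0r mulr1 mulN1r ltr0_norm.
have mW : smeasurable <<s G>> W.
  apply: smeasurableD; last (apply: smeasurableM; first exact: smeasurable_cst);
    apply: smeasurable_indic.
  - rewrite (_ : [set _ | _] = h @^-1` `[0, +oo[); first exact: mh.
    by apply/seteqP; split=> w /=; rewrite in_itv/= andbT.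
  - rewrite (_ : [set _ | _] = h @^-1` `]-oo, 0[); first exact: mh.
    by apply/seteqP; split=> w /=; rewrite in_itv/=.
have Inh : P.-integrable setT (EFin \o (fun w => `|h w|)) by exact: integrable_norm.
have := pull_out Gm Ih h0 mW; under eq_fun do rewrite WhE.
move=> /(_ Inh) Eh.
have /(ae_eq_integral_abs P measurableT) : (\int[P]_w `|(h w)%:E|)%E = 0%E.
  by rewrite -[RHS]/(0%R%:E) -Eh EFin_ex.
move=> /(_ (measurable_int _ Ih)); apply: filterS => w /(_ I) [].
by rewrite /h mulN1r => /eqP; rewrite subr_eq0 => /eqP.
Qed.

End Expectation.

(** * Conditional mean and variance paired with measurable test functions *)

Section ConditionalExpectation.
Context {d : measure_display} {T : measurableType d} {R : realType}.
Variable P : probability T R.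
Implicit Types (Z Y V L W : T -> R).
Variable G : set_system T.
Hypothesis Gm : G `<=` measurable.

(** [Z - Y] integrates to zero over each event of the sub-sigma-algebra, since [Y] agrees almost
    surely with a version; [pull_out] extends this from events to [W]. *)
Lemma condexp_eq_ex Z Y W : condexp_eq P <<s G>> Z Y ->
  finite_moments P Z -> finite_moments P Y ->
  smeasurable <<s G>> W -> finite_moments P W ->
  ex P (fun w => W w * Z w) = ex P (fun w => W w * Y w).
Proof.
move=> [M [[mM IZ IM MZ] MY]] fZ fY mW fW.
have fg : finite_moments P (fun w => Z w + -1 * Y w).
  by apply: finite_momentsD => //; apply: finite_momentsM => //;
    exact: finite_moments_cst.
have g0 A : <<s G>> A -> ex P (fun w => \1_A w * (Z w + -1 * Y w)) = 0.
  move=> GA; have mA : measurable A.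
    by apply: (smallest_sub (@sigma_algebra_measurable _ _) Gm) GA.
  have : (\int[P]_(w in A) (Y w)%:E = \int[P]_(w in A) (Z w)%:E)%E.
    rewrite -MZ//; apply: ae_eq_integral => //.
    - apply: measurable_funTS; exact: measurable_int (finite_moments_integrable fY).
    - by apply: measurable_funTS; exact: measurable_int IM.
    - by apply: filterS MY => w ->.
  rewrite !integral_indic_ex// => -[E].
  transitivity (ex P (fun w => \1_A w * Z w + -1 * (\1_A w * Y w))).
    by apply: eq_ex => w; ring.
  have fA : finite_moments P (\1_A : T -> R) by exact: finite_moments_indic.
  have fAZ := finite_momentsM fA fZ; have fAY := finite_momentsM fA fY.
  rewrite exD//; last by apply: finite_momentsM => //; exact: finite_moments_cst.
  by rewrite exZ// E mulN1r subrr.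
have := pull_out Gm (finite_moments_integrable fg) g0 mW
  (finite_moments_integrable (finite_momentsM fW fg)).
have fWZ := finite_momentsM fW fZ; have fWY := finite_momentsM fW fY.
have -> : ex P (fun w => W w * (Z w + -1 * Y w)) =
    ex P (fun w => W w * Z w + -1 * (W w * Y w)).
  by apply: eq_ex => w; ring.
rewrite exD//; last by apply: finite_momentsM => //; exact: finite_moments_cst.
by rewrite exZ// mulN1r => /eqP; rewrite subr_eq0 => /eqP.
Qed.

(** Adding the squared conditional mean to the conditional variance gives the conditional
    expectation of [Z ^+ 2], to which [condexp_eq_ex] applies. *)
Lemma condvar_eq_ex Z V L W : condexp_eq P <<s G>> Z L ->
  condvar_eq P <<s G>> Z V ->
  finite_moments P Z -> finite_moments P V -> finite_moments P L ->
  smeasurable <<s G>> W -> finite_moments P W ->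
  ex P (fun w => W w * Z w ^+ 2) = ex P (fun w => W w * (V w + L w ^+ 2)).
Proof.
move=> [M' [[mM' IZ' IM' MZ'] ML]] [M [M2 [[mM IZ IM MZ] cM2 MV]]] fZ fV fL mW fW.
apply: condexp_eq_ex => //; last 2 first.
- exact: finite_momentsM.
- by apply: finite_momentsD => //; exact: finite_momentsM.
exists M2; split=> //.
(* The two hypotheses supply separate versions of the conditional mean, which agree almost
   surely. *)
have MM' : {ae P, forall w, M w = M' w}.
  apply: (smeasurable_ae_eq Gm mM mM') => // A GA.
  by rewrite MZ// MZ'.
apply: filterS3 MM' ML MV => w -> -> <-; by rewrite subrK.
Qed.

End ConditionalExpectation.

(** * Tridiagonal matrices and q-commutation *)

Section Recurrence.
Context {R : realType}.
Variables (eta theta sigma tau : R).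

(* The sequence v acts as a row vector; jacobi a b c v is its product with the
   tridiagonal matrix whose n-th column is (c n, b n, a n). *)
Definition jacobi (a b c v : nat -> R) (n : nat) : R :=
  a n * v n.+1 + b n * v n + c n * v n.-1.

(** The recurrence coefficients are affine in [t]: [xb], [xc] are constant terms, [ya], [yb], [yc]
    are slopes, and the leading coefficient has constant term 1. *)
Definition ya (n : nat) : R := if n is 0 then 0 else sigma.
Definition xb (n : nat) : R := match n with
  | 0 => 0
  | 1 => (eta * tau + theta) / (1 - sigma * tau)
  | _ => (theta + 2 * eta * tau + theta * sigma * tau) / (1 - sigma * tau) ^+ 2
  end.
Definition yb (n : nat) : R := match n with
  | 0 => 0
  | 1 => (eta + theta * sigma) / (1 - sigma * tau)
  | _ => (eta + 2 * theta * sigma + eta * sigma * tau) / (1 - sigma * tau) ^+ 2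
  end.
(** The value 0 at index 0 matters: since [0.-1] is [0], it removes the term that stands for index
    -1. The same holds for [xc]. *)
Definition yc (n : nat) : R := match n with
  | 0 => 0
  | 1 => 1
  | 2 => ((1 - sigma * tau) ^+ 2
          + (eta + theta * sigma) * (theta + eta * tau)) / (1 - sigma * tau) ^+ 3
  | _ => ((1 - sigma * tau) ^+ 2
          + (eta + theta * sigma) * (theta + eta * tau)) / (1 - sigma * tau) ^+ 4
  end.
Definition xc (n : nat) : R := match n with 0 | 1 => 0 | _ => tau * yc n end.

Definition Xop := jacobi (fun=> 1) xb xc.
Definition Yop := jacobi ya yb yc.

Hypothesis st1 : 1 - sigma * tau != 0.

(* Operators act on row vectors, so Xop (Yop v) is the matrix product v y x. *)
Lemma q_commutation (v : nat -> R) (k : nat) :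
  Xop (Yop v) k = v k + eta * Xop v k + theta * Yop v k + sigma * Xop (Xop v) k
    + tau * Yop (Yop v) k - sigma * tau * Yop (Xop v) k.
Proof.
rewrite /Xop /Yop /jacobi.
(* Entry [k] involves coefficients of index [k - 1] to [k + 1], which are constant from index 3 on;
   hence four particular cases and a generic one. *)
case: k => [|[|[|[|k]]]] /=; by field.
Qed.

Definition Jop (t : R) := jacobi (fun n => 1 + ya n * t)
  (fun n => xb n + yb n * t) (fun n => xc n + yc n * t).

Lemma JopE t v k : Jop t v k = Xop v k + t * Yop v k.
Proof. by rewrite /Jop /Xop /Yop /jacobi; ring. Qed.

Lemma Jop2E s t v k : Jop t (Jop s v) k =
  Xop (Xop v) k + s * Xop (Yop v) k + t * (Yop (Xop v) k + s * Yop (Yop v) k).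
Proof. by rewrite JopE {1}/Xop {1}/Yop /jacobi !JopE /Xop /Yop /jacobi; ring. Qed.

(** A tridiagonal matrix looks only one index ahead; applied twice, it looks two ahead. *)
Lemma Jop_perturb (v v' : nat -> R) (t : R) (k : nat) :
  (forall j, (j <= k)%N -> v' j = v j) ->
  Jop t v' k = Jop t v k + (1 + ya k * t) * (v' k.+1 - v k.+1).
Proof.
move=> vv'; rewrite /Jop /jacobi (vv' _ (leqnn k)) (vv' _ (leq_pred k)); ring.
Qed.

Lemma Jop2_perturb (v v' : nat -> R) (t : R) (k : nat) :
  (forall j, (j <= k.+1)%N -> v' j = v j) ->
  Jop t (Jop t v') k = Jop t (Jop t v) k
    + (1 + ya k * t) * ((1 + ya k.+1 * t) * (v' k.+2 - v k.+2)).
Proof.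
move=> vv'; rewrite (@Jop_perturb (Jop t v)) => [|j jk].
  by rewrite (Jop_perturb _ vv'); ring.
rewrite (@Jop_perturb v v') => [|i ij]; last exact/vv'/(leq_trans ij)/leqW.
by rewrite vv' ?subrr ?mulr0 ?addr0.
Qed.

(** The conditional variance identity with a single vector [v] at all three times. Both sides expand
    in words of length at most two in x and y, and replacing [y x] by [q_commutation] makes them
    agree. *)
Lemma Jop_quadratic (v : nat -> R) (k : nat) (s t u : R) : u - s != 0 ->
  u * (1 + sigma * s) + tau + sigma * tau * s != 0 ->
  let K := (u - t) * (t - s) / (u * (1 + sigma * s) + tau + sigma * tau * s) in
  let SS := Jop s (Jop s v) k in
  let SU := Jop u (Jop s v) k in
  let UU := Jop u (Jop u v) k in
  Jop t (Jop t v) k =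
   ((u - t) ^+ 2 * SS + 2 * (u - t) * (t - s) * SU + (t - s) ^+ 2 * UU) / (u - s) ^+ 2
   + K * (v k + eta * (u * Jop s v k - s * Jop u v k) / (u - s)
          + theta * (Jop u v k - Jop s v k) / (u - s)
          + sigma * (u ^+ 2 * SS - 2 * u * s * SU + s ^+ 2 * UU) / (u - s) ^+ 2
          + tau * (UU - 2 * SU + SS) / (u - s) ^+ 2
          - (1 + sigma * tau) * ((u + s) * SU - s * UU - u * SS) / (u - s) ^+ 2).
Proof.
move=> us0 D0 K SS SU UU; rewrite /K /SS /SU /UU !Jop2E !JopE q_commutation.
by field; rewrite us0 D0.
Qed.

End Recurrence.

(** * The polynomials defined by the three-step recurrence *)

Section MartingalePolynomials.
Context {R : realType}.
Variables (eta theta sigma tau : R).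
Local Notation ya := (ya sigma).
Local Notation xb := (xb eta theta sigma tau).
Local Notation yb := (yb eta theta sigma tau).
Local Notation xc := (xc eta theta sigma tau).
Local Notation yc := (yc eta theta sigma tau).

(** Carrying two consecutive polynomials makes the recursion structural; the initial 0 stands for
    degree -1. *)
Fixpoint mart_poly_pair (t : R) (n : nat) : {poly R} * {poly R} :=
  if n is m.+1 then
    let: (p, q) := mart_poly_pair t m in
    (q, (1 + ya m * t)^-1 *:
        (('X - (xb m + yb m * t)%:P) * q - (xc m + yc m * t) *: p))
  else (0, 1).

Definition mart_poly (n : nat) (t : R) : {poly R} := (mart_poly_pair t n).2.

Lemma mart_polyS n t : mart_poly n.+1 t = (1 + ya n * t)^-1 *:
  (('X - (xb n + yb n * t)%:P) * mart_poly n t - (xc n + yc n * t) *: mart_poly n.-1 t).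
Proof.
(* For [n = 0] the statement has [mart_poly 0] where the pair has 0; the coefficient in front
   vanishes. *)
case: n => [|n]; rewrite /mart_poly /=;
  first by rewrite scaler0 (mul0r t) (addr0 0) scale0r.
by case: (mart_poly_pair t n).
Qed.

Hypothesis sigma0 : 0 <= sigma.

Lemma ya_gt0 n t : 0 < t -> 0 < 1 + ya n * t.
Proof. by move=> t0; rewrite ltr_wpDr// mulr_ge0// ?(ltW t0)//; case: n. Qed.

Lemma mart_poly_rec n t : 0 < t -> 'X * mart_poly n t = (1 + ya n * t) *: mart_poly n.+1 t
  + (xb n + yb n * t) *: mart_poly n t + (xc n + yc n * t) *: mart_poly n.-1 t.
Proof.
move=> t0; rewrite mart_polyS scalerA divff ?gt_eqF ?ya_gt0// scale1r.
by rewrite mulrBl mul_polyC addrAC !subrK.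
Qed.

Lemma size_mart_poly n t : 0 < t -> size (mart_poly n t) = n.+1.
Proof.
move=> t0;
  suff: size (mart_poly n t) = n.+1 /\ (size (mart_poly n.-1 t) <= n.+1)%N
  by case.
elim: n => [|n [IH1 IH2]]; first by rewrite /mart_poly /= size_poly1.
split; last by rewrite /= IH1.
rewrite mart_polyS size_scale ?invr_neq0 ?gt_eqF ?ya_gt0//.
have q0 : mart_poly n t != 0 by rewrite -size_poly_eq0 IH1.
have sX : size (('X - (xb n + yb n * t)%:P) * mart_poly n t) = n.+2.
  by rewrite size_mul ?polyXsubC_eq0// size_XsubC IH1.
rewrite size_polyDl// size_polyN sX.
by apply: leq_ltn_trans (size_scale_leq _ _) _.
Qed.

(** The recurrence read as an eigenvector relation, so that [Jop] stands for multiplication by the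
    variable. *)
Lemma jop_mart_poly t x : 0 < t ->
  Jop eta theta sigma tau t (fun k => (mart_poly k t).[x]) =1 fun n => x * (mart_poly n t).[x].
Proof.
move=> t0 n; have /(congr1 (fun p => p.[x])) := mart_poly_rec n t0.
by rewrite hornerM hornerX => ->; rewrite /Jop /jacobi !hornerD !hornerZ.
Qed.

End MartingalePolynomials.

(** * Measurability of the process for its own sigma-algebras *)

Section Process.
Context {d : measure_display} {T : measurableType d} {R : realType}.
Variable P : probability T R.
Variable X : R -> {RV P >-> R}.

Definition process_generator (I : set R) : set_system T :=
  \bigcup_(t in I) preimage_set_system [set: T] (X t) measurable.

Lemma process_generator_measurable I : process_generator I `<=` measurable.
Proof. by move=> A [t It [B mB <-]]; exact: (@measurable_funPT _ _ _ _ (X t)). Qed.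

Lemma smeasurable_process (I : set R) t : I t ->
  smeasurable (sigma_process X I) (X t).
Proof.
move=> It B mB; apply: sub_gen_smallest; exists t => //.
by exists B; rewrite ?setTI.
Qed.

Lemma smeasurable_sub (I J : set R) (W : T -> R) : I `<=` J ->
  smeasurable (sigma_process X I) W -> smeasurable (sigma_process X J) W.
Proof.
move=> IJ mW B mB; apply: sub_sigma_algebra2 (mW _ mB).
exact: bigcup_subset.
Qed.

End Process.

(** * Linear regression and conditional variance in integrated form *)

Section Harness.
Context {d : measure_display} {T : measurableType d} {R : realType}.
Variable P : probability T R.
Variable X : R -> {RV P >-> R}.
Variables (eta theta sigma tau : R).
Hypothesis Xqh : quadratic_harness X (- (sigma * tau)) eta theta sigma tau.
Hypothesis hst : 0 <= sigma * tau < 1.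
Hypothesis Xmom : forall t, 0 < t -> all_moments (X t).
Implicit Types (W : T -> R) (s t u : R).

Let sigma0 : 0 <= sigma. Proof. by case: Xqh. Qed.
Let tau0 : 0 <= tau. Proof. by case: Xqh. Qed.
Let st1 : 1 - sigma * tau != 0.
Proof. by rewrite gt_eqF// subr_gt0; case/andP: hst. Qed.

Local Notation past s := (past_filtration X s).
Local Notation pol := (mart_poly eta theta sigma tau).
Local Notation J := (Jop eta theta sigma tau).

Lemma finite_moments_process t : 0 < t -> finite_moments P (X t).
Proof.
move=> t0; split=> // n; have := integrable_norm (Xmom t0 n).
by apply: eq_integrable => // w _ /=; rewrite normrX.
Qed.
Let fX := finite_moments_process.

Lemma finite_moments_pol n t u : 0 < u ->
  finite_moments P (fun w => (pol n t).[X u w]).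
Proof. by move=> u0; apply: finite_moments_horner; exact: fX. Qed.

Lemma smeasurable_two_sided s u W : smeasurable (past s) W ->
  smeasurable (two_sided_filtration X s u) W.
Proof. by apply: smeasurable_sub => t /= ?; left. Qed.

Lemma smeasurable_past s t W : s <= t -> smeasurable (past s) W ->
  smeasurable (past t) W.
Proof.
move=> st; apply: smeasurable_sub => r /= /andP[-> rs].
exact: le_trans st.
Qed.

Lemma smeasurable_past_process s : 0 < s -> smeasurable (past s) (X s).
Proof. by move=> s0; apply: smeasurable_process => /=; rewrite s0 lexx. Qed.

(** The test function may involve [X u] besides the past of [s]; the induction on the degree relies
    on this. *)
Lemma harness_linear s t u W : 0 < s -> s < t -> t < u ->
  smeasurable (two_sided_filtration X s u) W -> finite_moments P W ->
  (u - s) * ex P (fun w => X t w * W w) =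
  (u - t) * ex P (fun w => X s w * W w) + (t - s) * ex P (fun w => X u w * W w).
Proof.
move=> s0 st tu mW fW.
have t0 := lt_trans s0 st; have u0 := lt_trans t0 tu.
have us0 : u - s != 0 by rewrite subr_eq0 gt_eqF// (lt_trans st tu).
have fXs := fX s0; have fXt := fX t0; have fXu := fX u0.
have fsW := finite_momentsM fXs fW; have fuW := finite_momentsM fXu fW.
have := condexp_eq_ex (@process_generator_measurable _ _ _ _ _ _)
  (qh_condexp Xqh s0 st tu) fXt _ mW fW.
move=> /(_ _)/wrap[].
  by apply: finite_momentsD; apply: finite_momentsM => //;
    exact: finite_moments_cst.
under eq_fun do rewrite mulrC.
move=> ->.
transitivity ((u - s) * ex P (fun w => (u - t) / (u - s) * (X s w * W w)
   + (t - s) / (u - s) * (X u w * W w))).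
  by congr (_ * _); apply: eq_ex => w; ring.
rewrite exD; [|apply: finite_momentsM => //; exact: finite_moments_cst..].
by rewrite !exZ//; field.
Qed.

Lemma denominator_gt0 s u : 0 < s -> 0 < u ->
  0 < u * (1 + sigma * s) + tau + sigma * tau * s.
Proof.
move=> s0 u0; rewrite ltr_wpDr//.
  by rewrite mulr_ge0 ?(ltW s0)//; case/andP: hst.
by rewrite ltr_wpDr// mulr_gt0// ltr_wpDr// mulr_ge0// ltW.
Qed.

(** The right-hand side is arranged as in [Jop_quadratic], so that the two can be subtracted. *)
Lemma harness_quadratic s t u W : 0 < s -> s < t -> t < u ->
  smeasurable (two_sided_filtration X s u) W -> finite_moments P W ->
  let K := (u - t) * (t - s) / (u * (1 + sigma * s) + tau + sigma * tau * s) in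
  let S := ex P (fun w => X s w * W w) in
  let U := ex P (fun w => X u w * W w) in
  let SS := ex P (fun w => X s w * (X s w * W w)) in
  let SU := ex P (fun w => X u w * (X s w * W w)) in
  let UU := ex P (fun w => X u w * (X u w * W w)) in
  ex P (fun w => X t w * (X t w * W w)) =
   ((u - t) ^+ 2 * SS + 2 * (u - t) * (t - s) * SU + (t - s) ^+ 2 * UU) / (u - s) ^+ 2
   + K * (ex P W + eta * (u * S - s * U) / (u - s)
          + theta * (U - S) / (u - s)
          + sigma * (u ^+ 2 * SS - 2 * u * s * SU + s ^+ 2 * UU) / (u - s) ^+ 2
          + tau * (UU - 2 * SU + SS) / (u - s) ^+ 2
          - (1 + sigma * tau) * ((u + s) * SU - s * UU - u * SS) / (u - s) ^+ 2).
Proof.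
move=> s0 st tu mW fW K S U SS SU UU.
have t0 := lt_trans s0 st; have u0 := lt_trans t0 tu.
have us0 : u - s != 0 by rewrite subr_eq0 gt_eqF// (lt_trans st tu).
have D0 := lt0r_neq0 (denominator_gt0 s0 u0).
have fXs := fX s0; have fXt := fX t0; have fXu := fX u0.
have fsW := finite_momentsM fXs fW; have fuW := finite_momentsM fXu fW.
have fssW := finite_momentsM fXs fsW; have fusW := finite_momentsM fXu fsW.
have fuuW := finite_momentsM fXu fuW.
have fL : finite_moments P
    (fun w => (u - t) / (u - s) * X s w + (t - s) / (u - s) * X u w).
  by apply: finite_momentsD; exact: finite_momentsZ.
have fD : finite_moments P (Delta X s u).
  rewrite (_ : Delta X s u = fun w => (u - s)^-1 * (X u w + -1 * X s w));
    last first.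
    by apply/funext => w; rewrite /Delta mulN1r mulrC.
  by apply/finite_momentsZ/finite_momentsD => //; exact: finite_momentsZ.
have ftD : finite_moments P (tDelta X s u).
  rewrite (_ : tDelta X s u = fun w => (u - s)^-1 * (u * X s w + - s * X u w)).
    by apply/finite_momentsZ/finite_momentsD => //; exact: finite_momentsZ.
  by apply/funext => w; rewrite /tDelta mulNr mulrC.
have := condvar_eq_ex (@process_generator_measurable _ _ _ _ _ _)
  (qh_condexp Xqh s0 st tu) (qh_condvar Xqh s0 st tu) fXt _ fL mW fW.
move=> /(_ _)/wrap[].
  have fN f : finite_moments P f -> finite_moments P (fun w => - f w).
    by move=> /(finite_momentsZ (-1)); under eq_fun do rewrite mulN1r.
  have fsq f : finite_moments P f -> finite_moments P (fun w => f w ^+ 2).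
    by move=> ff; exact: finite_momentsM.
  apply: finite_momentsZ.
  apply: finite_momentsD; last by apply: (fN); apply: finite_momentsM => //;
    exact: finite_momentsZ.
  do 4 (apply: finite_momentsD; last by apply: finite_momentsZ => //; exact: fsq).
  exact: finite_moments_cst.
move=> E; transitivity (ex P (fun w => W w * X t w ^+ 2)).
  by apply: eq_ex => w; ring.
rewrite E => {E}.
pose c := (u - s)^-1.
(* The conditional second moment times [W], expanded in the six monomials of degree at most two in
   [X s] and [X u]. *)
transitivity (ex P (fun w => K * W w
  + ((K * (eta * u - theta) * c) * (X s w * W w)
  + ((K * (theta - eta * s) * c) * (X u w * W w)
  + (((u - t) ^+ 2 + K * (sigma * u ^+ 2 + tau + (1 + sigma * tau) * u)) * c ^+ 2
       * (X s w * (X s w * W w))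
  + ((2 * (u - t) * (t - s) - K * (2 * sigma * u * s + 2 * tau
       + (1 + sigma * tau) * (u + s))) * c ^+ 2 * (X u w * (X s w * W w))
  + ((t - s) ^+ 2 + K * (sigma * s ^+ 2 + tau + (1 + sigma * tau) * s)) * c ^+ 2
       * (X u w * (X u w * W w)))))))).
  apply: eq_ex => w; rewrite /c /K /Delta /tDelta.
  have -> : u * (1 + sigma * s) + tau - - (sigma * tau) * s =
      u * (1 + sigma * s) + tau + sigma * tau * s by ring.
  by field; rewrite us0 D0.
do 5 (rewrite exD;
  [|by repeat (apply: finite_momentsD || apply: finite_momentsZ)..]).
rewrite !exZ//.
rewrite /c -/S -/U -/SS -/SU -/UU; field.
by rewrite us0.
Qed.

(** By linear regression [E[X_u W]] is affine in [u] beyond [s], while Cauchy-Schwarz bounds its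
    square by a multiple of [u]; hence its slope is zero. *)
Lemma past_limit s t W : 0 < s -> s < t ->
  smeasurable (past s) W -> finite_moments P W ->
  ex P (fun w => X t w * W w) = ex P (fun w => X s w * W w).
Proof.
move=> s0 st mW fW.
pose y u := ex P (fun w => X u w * W w).
pose B := ex P (fun w => W w ^+ 2).
have B0 : 0 <= B by apply: ex_ge0 => w; exact: sqr_ge0.
have yB u : 0 < u -> y u ^+ 2 <= u * B.
  move=> u0; have fXu := finite_moments_process u0.
  have := ex_CauchySchwarz fXu fW.
  have := qh_cov Xqh u0 u0; rewrite minxx unlock => E.
  suff -> : ex P (fun w => X u w ^+ 2) = u by [].
  by apply: EFin_inj; rewrite EFin_ex// finite_moments_integrable//;
    exact: finite_momentsM.
rewrite -/(y t) -/(y s); apply/eqP; rewrite -subr_eq0 -sqrf_eq0; apply/eqP.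
set D := (y t - y s) ^+ 2.
have D0 : 0 <= D by exact: sqr_ge0.
have key u : t < u -> (u - s) ^+ 2 * D <= 2 * (t - s) ^+ 2 * (u * B + y s ^+ 2).
  move=> tu; have u0 := lt_trans (lt_trans s0 st) tu.
  have H := harness_linear s0 st tu (smeasurable_two_sided mW) fW.
  rewrite -/(y t) -/(y s) -/(y u) in H.
  have E : (u - s) * (y t - y s) = (t - s) * (y u - y s).
    by rewrite mulrBr H; ring.
  rewrite /D -exprMn E exprMn.
  have := yB u u0; have := sqr_ge0 (y u + y s); have := sqr_ge0 (t - s) => h1 h2 h3.
  have -> : 2 * (t - s) ^+ 2 * (u * B + y s ^+ 2) = (t - s) ^+ 2 * (2 * (u * B + y s ^+ 2)).
    by ring.
  by rewrite ler_wpM2l//; lra.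
apply/eqP; rewrite eq_le D0 andbT leNgt; apply/negP => {}D0.
pose a := 2 * (t - s) ^+ 2 * (B + y s ^+ 2).
have a0 : 0 <= a.
  apply: mulr_ge0; first by rewrite mulr_ge0// sqr_ge0.
  by rewrite addr_ge0// sqr_ge0.
have t0 := lt_trans s0 st.
(* At [u = s + r] the bound [key] gives [r * D <= 2 * a], whereas this [r] satisfies
   [r * D = 2 * a + (t + 1) * D]. *)
pose r := 2 * (a / D) + t + 1.
have aD0 : 0 <= a / D by rewrite divr_ge0// ltW.
have rt : t + 1 <= r by rewrite /r; lra.
have r0 : 0 < r by lra.
have tsr : t < s + r by lra.
have := key _ tsr; rewrite [s + r]addrC addrK => K.
have c0 : 0 <= 2 * (t - s) ^+ 2 by rewrite mulr_ge0// sqr_ge0.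
have le1 : (r + s) * B + y s ^+ 2 <= 2 * r * (B + y s ^+ 2).
  have := sqr_ge0 (y s); nra.
have /(le_trans K) : 2 * (t - s) ^+ 2 * ((r + s) * B + y s ^+ 2) <= r * (2 * a).
  by rewrite (le_trans (ler_wpM2l c0 le1))// /a le_eqVlt; apply/orP; left;
    apply/eqP; ring.
rewrite expr2 -mulrA ler_pM2l// leNgt => /negP; apply.
have -> : r * D = 2 * a + (t + 1) * D by rewrite /r; field; rewrite gt_eqF.
by rewrite ltrDl mulr_gt0//; lra.
Qed.

(** * The martingale property by induction on the degree *)

Local Notation e n t V := (ex P (fun w => (pol n t).[X t w] * V w)).

Lemma ex_jop n t V : 0 < t -> finite_moments P V ->
  ex P (fun w => X t w * ((pol n t).[X t w] * V w)) = J t (fun k => e k t V) n.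
Proof.
move=> t0 fV; have fp k := finite_momentsM (finite_moments_pol k t t0) fV.
rewrite /Jop /jacobi -!exZ// -!exD//;
  try by repeat (apply: finite_momentsD || apply: finite_momentsZ).
apply: eq_ex => w; rewrite mulrA.
by rewrite -(jop_mart_poly eta theta tau sigma0 _ t0 n) /Jop /jacobi; ring.
Qed.

(** The test functions are not just indicators, because the induction replaces [V] by its products
    with [X s]. *)
Definition martingale_pol n := forall s u V, 0 < s -> s < u ->
  smeasurable (past s) V -> finite_moments P V -> e n u V = e n s V.

Lemma martingale_pol0 : martingale_pol 0.
Proof. by move=> s u V *; apply: eq_ex => w; rewrite !hornerC. Qed.

Lemma pol1 t : pol 1 t = 'X.
Proof.
by rewrite mart_polyS /= (mul0r t) !addr0 scale0r invr1 scale1r !subr0 mulr1.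
Qed.

Lemma martingale_pol1 : martingale_pol 1.
Proof.
by move=> s u V *; rewrite !pol1; under eq_ex do rewrite hornerX;
  under [RHS]eq_ex do rewrite hornerX; exact: past_limit.
Qed.

(** This factor multiplies the unknown at time [u] once the unknown at time [t] is eliminated. It is
    a product of positive terms. *)
Lemma determinant_neq0 k s t u : 0 < s -> s < t -> t < u ->
  (t - s) / (u - s) * (1 + ya sigma k * t) -
  ((t - s) ^+ 2 / (u - s) ^+ 2
   + (u - t) * (t - s) / (u * (1 + sigma * s) + tau + sigma * tau * s)
     * (sigma * s ^+ 2 + tau + (1 + sigma * tau) * s) / (u - s) ^+ 2)
  * (1 + ya sigma k * u) != 0.
Proof.
move=> s0 st tu.
have us : 0 < u - s by rewrite subr_gt0 (lt_trans st).
have ts : 0 < t - s by rewrite subr_gt0.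
have ut : 0 < u - t by rewrite subr_gt0.
have ss : 0 < 1 + sigma * s by rewrite ltr_wpDr// mulr_ge0// ltW.
have D0 := denominator_gt0 s0 (lt_trans (lt_trans s0 st) tu).
have st0 : 0 < 1 - sigma * tau by rewrite subr_gt0; case/andP: hst.
suff [c c0 ->] : exists2 c, 0 < c & ((t - s) / (u - s) * (1 + ya sigma k * t) -
  ((t - s) ^+ 2 / (u - s) ^+ 2
   + (u - t) * (t - s) / (u * (1 + sigma * s) + tau + sigma * tau * s)
     * (sigma * s ^+ 2 + tau + (1 + sigma * tau) * s) / (u - s) ^+ 2)
  * (1 + ya sigma k * u)) = (t - s) * (u - t) / (u - s)
    / (u * (1 + sigma * s) + tau + sigma * tau * s) * (1 + sigma * s) * c.
  by rewrite gt_eqF// !mulr_gt0// invr_gt0.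
(* The last factor is 1 at index 0, where [ya] is 0, and [1 - sigma * tau] afterwards. *)
case: k => [|k] /=; [exists 1 => //|exists (1 - sigma * tau) => //]; field;
  by rewrite !gt_eqF.
Qed.

Lemma martingale_polS k : (forall j, (j <= k.+1)%N -> martingale_pol j) ->
  martingale_pol k.+2.
Proof.
move=> IH s u V s0 su mV fV.
(* Any intermediate time supplies the two equations; the midpoint is taken. *)
pose t := (s + u) / 2.
have st : s < t by rewrite midf_lt.
have tu : t < u by rewrite midf_lt.
have t0 := lt_trans s0 st; have u0 := lt_trans t0 tu.
have us0 : u - s != 0 by rewrite subr_eq0 gt_eqF.
have D0 : u * (1 + sigma * s) + tau + sigma * tau * s != 0.
  exact/lt0r_neq0/denominator_gt0.
pose v j := e j s V.
pose vt j := e j t V.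
pose vu j := e j u V.
have vtE j : (j <= k.+1)%N -> vt j = v j by move=> jk; exact: IH.
have vuE j : (j <= k.+1)%N -> vu j = v j by move=> jk; exact: IH.
have fXs := finite_moments_process s0.
have fXt := finite_moments_process t0.
have fXu := finite_moments_process u0.
have fsV := finite_momentsM fXs fV; have ftV := finite_momentsM fXt fV.
have mVt := smeasurable_past (ltW st) mV.
have mXs := smeasurable_past_process s0.
have mXt := smeasurable_past_process t0.
have mXsV : smeasurable (past s) (fun w => X s w * V w) by exact: smeasurableM.
have mXtV : smeasurable (past t) (fun w => X t w * V w) by exact: smeasurableM.
have mpu j : smeasurable (two_sided_filtration X s u)
    (fun w => (pol j u).[X u w] * V w).
  apply: smeasurableM; last exact: smeasurable_two_sided.
  apply: smeasurable_horner; apply: smeasurable_process => /=; right; exact: lexx.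
have fpu j : finite_moments P (fun w => (pol j u).[X u w] * V w).
  by apply: finite_momentsM => //; exact: finite_moments_pol.
have swap j r (f g : T -> R) :
    ex P (fun w => f w * ((pol j r).[X r w] * g w)) = e j r (fun w => f w * g w).
  by apply: eq_ex => w; ring.
(* [X r * V] is again measurable for the past of [r], so the induction hypothesis moves the
   polynomial from time [u] to [r] before [Jop] enters. *)
have eXr r j : 0 < r -> r < u -> smeasurable (past r) V -> (j <= k.+1)%N ->
    ex P (fun w => X r w * ((pol j u).[X u w] * V w)) = J r (fun i => e i r V) j.
  move=> r0 ru mVr jk; have fXr := finite_moments_process r0.
  rewrite swap (IH _ jk _ _ _ r0 ru) -?swap ?ex_jop//; last exact: finite_momentsM.
  by apply: smeasurableM => //; exact: smeasurable_past_process.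
have eXrr r : 0 < r -> r < u -> smeasurable (past r) V ->
    ex P (fun w => X r w * (X r w * ((pol k u).[X u w] * V w))) =
    J r (J r (fun i => e i r V)) k.
  move=> r0 ru mVr; have fXr := finite_moments_process r0.
  have fXV := finite_momentsM fXr fV.
  have mXr := smeasurable_past_process r0.
  transitivity (ex P (fun w => (pol k u).[X u w] * (X r w * (X r w * V w)))).
    by apply: eq_ex => w; ring.
  rewrite (IH _ (leqnSn k) _ _ _ r0 ru); last 2 first.
  - by do 2 apply: smeasurableM => //.
  - exact: finite_momentsM.
  rewrite -swap ex_jop//; congr (J r _ k); apply/funext => j.
  by rewrite -swap ex_jop.
have eXuu : ex P (fun w => X u w * (X u w * ((pol k u).[X u w] * V w))) =
    J u (J u vu) k.
  transitivity (ex P (fun w => X u w * ((pol k u).[X u w] * (X u w * V w)))).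
    by apply: eq_ex => w; ring.
  rewrite ex_jop//; last exact: finite_momentsM.
  by congr (J u _ k); apply/funext => j; rewrite -swap ex_jop.
have eXu j : ex P (fun w => X u w * ((pol j u).[X u w] * V w)) = J u vu j.
  exact: ex_jop.
(* Absorbing [X u] at time [u] reaches only degree [k.+1]; these entries move to time [s] by
   induction, so no unknown appears. *)
have eXus : ex P (fun w => X u w * (X s w * ((pol k u).[X u w] * V w))) =
    J u (J s v) k.
  transitivity (ex P (fun w => X u w * ((pol k u).[X u w] * (X s w * V w)))).
    by apply: eq_ex => w; ring.
  rewrite ex_jop//.
  have eXs j : (j <= k.+1)%N -> e j u (fun w => X s w * V w) = J s v j.
    by move=> jk; rewrite -swap eXr.
  rewrite (@Jop_perturb _ _ _ _ _ (J s v)) => [|j jk]; last exact/eXs/leqW.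
  by rewrite eXs// subrr mulr0 addr0.
(* The part built from [v] cancels because [Jop] is affine in time; only the differences in degree
   [k.+2] remain. *)
have lin : (1 + ya sigma k.+1 * t) * (vt k.+2 - v k.+2) * (u - s) =
    (t - s) * ((1 + ya sigma k.+1 * u) * (vu k.+2 - v k.+2)).
  have := harness_linear s0 st tu (mpu k.+1) (fpu k.+1).
  rewrite (eXr t)// (eXr s)// eXu -/vt -/v (Jop_perturb _ _ _ _ _ vtE) (Jop_perturb _ _ _ _ _ vuE).
  rewrite !JopE; set A := Xop _ _ _ _ _ _; set B := Yop _ _ _ _ _ _ => H.
  move/eqP: H; rewrite -subr_eq0 => /eqP H; apply/eqP; rewrite -subr_eq0; apply/eqP.
  by rewrite -[RHS]H; ring.
(* [Jop_quadratic] cancels the part built from [v]. The factor is the total coefficient of [UU], the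
   only term on the right of [harness_quadratic] that reaches the unknown. *)
have quad : (1 + ya sigma k * t) * ((1 + ya sigma k.+1 * t) * (vt k.+2 - v k.+2)) =
    ((t - s) ^+ 2 / (u - s) ^+ 2
   + (u - t) * (t - s) / (u * (1 + sigma * s) + tau + sigma * tau * s)
     * (sigma * s ^+ 2 + tau + (1 + sigma * tau) * s) / (u - s) ^+ 2)
    * ((1 + ya sigma k * u) * ((1 + ya sigma k.+1 * u) * (vu k.+2 - v k.+2))).
  have := harness_quadratic s0 st tu (mpu k) (fpu k).
  rewrite /= (eXrr t)// (eXrr s)// (eXr s)// eXuu eXus eXu -/vt -/v -/(vu k) vuE//.
  rewrite (Jop2_perturb _ _ _ _ _ vtE) (Jop2_perturb _ _ _ _ _ vuE).
  rewrite (@Jop_perturb _ _ _ _ _ v vu) => [|j jk]; last exact/vuE/leqW.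
  rewrite (Jop_quadratic eta theta st1 v k t us0 D0).
  set SS := J s (J s v) k; set SU := J u (J s v) k; set UU := J u (J u v) k.
  set S := J s v k; set U := J u v k; set D := u * _ + _ + _.
  set dt := _ * (_ * (vt _ - _)); set du := _ * (_ * (vu _ - _)).
  rewrite vuE// subrr mulr0 addr0 => H.
  move/eqP: H; rewrite -subr_eq0 => /eqP H; apply/eqP; rewrite -subr_eq0; apply/eqP.
  by rewrite -[RHS]H; field; rewrite us0 D0.
set du := (1 + ya sigma k.+1 * u) * (vu k.+2 - v k.+2) in lin quad.
have lin' : (1 + ya sigma k.+1 * t) * (vt k.+2 - v k.+2) = (t - s) / (u - s) * du.
  by rewrite mulrAC -lin mulfK.
have /eqP : ((t - s) / (u - s) * (1 + ya sigma k * t) -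
    ((t - s) ^+ 2 / (u - s) ^+ 2
   + (u - t) * (t - s) / (u * (1 + sigma * s) + tau + sigma * tau * s)
     * (sigma * s ^+ 2 + tau + (1 + sigma * tau) * s) / (u - s) ^+ 2)
    * (1 + ya sigma k * u)) * du = 0.
  rewrite mulrBl -[X in _ - X]mulrA -quad lin'; ring.
rewrite mulf_eq0 (negbTE (determinant_neq0 k s0 st tu)) /= mulf_eq0.
by rewrite gt_eqF ?ya_gt0//= subr_eq0 => /eqP.
Qed.

Lemma martingale_polP n : martingale_pol n.
Proof.
elim/ltn_ind: n => -[|[|k]] IH; first exact: martingale_pol0.
  exact: martingale_pol1.
by apply: martingale_polS => j jk; exact: IH.
Qed.

(** * Vanishing means and orthogonality *)

Lemma ex_pol_eq0 n t : 0 < t -> (0 < n)%N -> e n t (fun=> 1) = 0.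
Proof.
move=> t0; elim/ltn_ind: n => -[//|n] IH _.
have fX1 := finite_moments_cst P 1.
have fXt := finite_moments_process t0.
have e1 r : 0 < r -> e 1 r (fun=> 1) = 0.
  move=> r0; rewrite (pol1 r); have := qh_mean Xqh r0; rewrite unlock => E.
  apply: EFin_inj; rewrite EFin_ex.
    rewrite -[RHS]E.
    by apply: eq_integral => w _; rewrite hornerX mulr1.
  by apply: finite_moments_integrable; apply: finite_momentsM => //;
    apply: finite_moments_horner; exact: finite_moments_process.
case: n IH => [|[|n]] IH; first exact: e1.
(* Degree two: [E[X_t^2] = t] is exactly the degree zero contribution in the recurrence, so nothing
   is left for the mean of [p_2]. *)
- have := ex_jop 1 t0 fX1; rewrite /Jop /jacobi (e1 _ t0) mulr0 addr0.
  have -> : e 0 t (fun=> 1) = 1.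
    rewrite -[RHS](ex_cst P 1); apply: eq_ex => w.
    by rewrite [(pol 0 t).[_]]hornerC mulr1.
  have -> : ex P (fun w => X t w * ((pol 1 t).[X t w] * 1)) = t.
    apply: EFin_inj; have := qh_cov Xqh t0 t0; rewrite minxx unlock => <-.
    rewrite EFin_ex.
      by apply: eq_integral => w _; rewrite (pol1 t) hornerX mulr1.
    apply: finite_moments_integrable; do 2 apply: finite_momentsM => //.
    exact: finite_moments_pol.
  rewrite add0r mul1r mulr1 => /eqP.
  rewrite -subr_eq0 opprD addrCA subrr addr0 oppr_eq0 mulf_eq0.
  by rewrite gt_eqF ?ya_gt0//= => /eqP.
(* [C] is the same at all times by the martingale property. The recurrence no longer reaches degree
   zero, so at time [s] only its top term survives. *)
- set C := e n.+3 t _.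
  have fp := finite_moments_pol n.+2 t t0.
  pose B := ex P (fun w => (pol n.+2 t).[X t w] ^+ 2).
  have B0 : 0 <= B by apply: ex_ge0 => w; exact: sqr_ge0.
  have CB s : 0 < s -> s < t -> C ^+ 2 <= s * B.
    move=> s0 st; have fXs := finite_moments_process s0.
    have m1 : smeasurable (past s) (fun=> 1 : R) by exact: smeasurable_cst.
    have es j : (j.+1 <= n.+2)%N -> e j.+1 s (fun=> 1) = 0.
      by move=> jn; rewrite -(@martingale_polP _ _ _ _ s0 st m1 fX1) IH.
    have H : ex P (fun w => X s w * (pol n.+2 t).[X t w]) = (1 + sigma * s) * C.
      transitivity (e n.+2 t (X s)); first by apply: eq_ex => w; rewrite mulrC.
      rewrite (@martingale_polP _ _ _ _ s0 st (smeasurable_past_process s0) fXs).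
      have := ex_jop n.+2 s0 fX1;
        rewrite /Jop /jacobi (es n.+1)// (es n)// !mulr0 !addr0.
      rewrite /C (@martingale_polP _ _ _ _ s0 st m1 fX1) => <-.
      by apply: eq_ex => w; ring.
    have := ex_CauchySchwarz fXs fp; rewrite H -/B.
    have -> : ex P (fun w => X s w ^+ 2) = s.
      apply: EFin_inj; have := qh_cov Xqh s0 s0; rewrite minxx unlock => <-.
      by rewrite EFin_ex//; exact/finite_moments_integrable/finite_momentsM.
    apply: le_trans; rewrite exprMn ler_peMl ?sqr_ge0// exprn_ege1// lerDl.
    by rewrite mulr_ge0// ltW.
  apply/eqP; rewrite -sqrf_eq0 eq_le sqr_ge0 andbT leNgt; apply/negP => C0.
  (* This time lies below [t] and makes [s * B] smaller than [C ^+ 2]. *)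
  pose s := t * (C ^+ 2 / (2 * C ^+ 2 + t * B)).
  have tB0 : 0 <= t * B by rewrite mulr_ge0// ltW.
  have d0 : 0 < 2 * C ^+ 2 + t * B by lra.
  have s0 : 0 < s by rewrite mulr_gt0// divr_gt0.
  have st : s < t by rewrite gtr_pMr// ltr_pdivrMr// mul1r; lra.
  have := CB _ s0 st; rewrite leNgt => /negP; apply.
  have -> : s * B = C ^+ 2 * (t * B / (2 * C ^+ 2 + t * B)).
    by rewrite /s; field; rewrite gt_eqF.
  by rewrite gtr_pMr// ltr_pdivrMr// mul1r; lra.
Qed.

(** [E[X_t p_k p_j]] can be expanded in either index. For [j > k + 1] the expansion in [j] meets
    only entries of row [k] beyond the diagonal, so the expansion in [k] forces entry [j] of row
    [k + 1] to vanish. *)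
Lemma ex_pol_orthogonal m n t : 0 < t -> (m < n)%N ->
  e m t (fun w => (pol n t).[X t w]) = 0.
Proof.
move=> t0; have fp k := finite_moments_pol k t t0.
pose F i j := e i t (fun w => (pol j t).[X t w]).
have FC i j : F i j = F j i by apply: eq_ex => w; rewrite mulrC.
(* Two consecutive rows are carried, as the recurrence goes two steps back. *)
suff H k : (forall j, (k < j)%N -> F k j = 0) /\
    (forall j, (k < j)%N -> F k.-1 j = 0) by exact: (H m).1.
elim: k => [|k [IH1 IH2]].
  have F0 j : (0 < j)%N -> F 0 j = 0.
    move=> j0; rewrite -(ex_pol_eq0 t0 j0); apply: eq_ex => w.
    by rewrite [(pol 0 t).[_]]hornerC mulrC.
  by [].
split=> j kj; last by apply: IH1; exact: ltnW.
have : J t (fun i => F i j) k = J t (fun i => F i k) j.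
  by rewrite -!ex_jop//; apply: eq_ex => w; ring.
rewrite /Jop /jacobi (IH1 j) 1?ltnW// (IH2 j) 1?ltnW// !(FC _ k) !IH1; first last.
- by rewrite ltnW// ltnW.
- by rewrite ltnW.
- by case: j kj.
rewrite !mulr0 !addr0 => /eqP; rewrite mulf_eq0 gt_eqF ?ya_gt0//=.
by move/eqP.
Qed.

Lemma orthogonal_martingale_pol :
  orthogonal_martingale_polynomials X pol.
Proof.
split=> [n t t0|n s t s0 st|n m t t0 nm].
- exact: size_mart_poly.
- have t0 := lt_trans s0 st.
  have mps : smeasurable (past s) (fun w => (pol n s).[X s w]).
    by apply: smeasurable_horner; exact: smeasurable_past_process.
  (* Being measurable for the past of [s], the right-hand side is its own version; the integral
     condition is [martingale_polP] with indicators as test functions. *)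
  exists (fun w => (pol n s).[X s w]); split; last exact: aeW.
  split=> //; [exact/finite_moments_integrable/finite_moments_pol..|move=> A FA].
  have mA : measurable A.
    apply: (smallest_sub (@sigma_algebra_measurable _ _)
      (@process_generator_measurable _ _ _ _ _ _)) FA.
  rewrite !integral_indic_ex//; [|exact: finite_moments_pol..].
  congr (_%:E); under eq_ex do rewrite mulrC; under [RHS]eq_ex do rewrite mulrC.
  rewrite (@martingale_polP _ _ _ _ s0 st)//; first exact: smeasurable_indic.
  exact: finite_moments_indic.
- rewrite unlock -EFin_ex; last first.
    by apply: finite_moments_integrable; apply: finite_momentsM => //;
      exact: finite_moments_pol.
  congr (_%:E); have [lt|lt|//] := ltngtP n m; first exact: ex_pol_orthogonal.
  by rewrite -[RHS](ex_pol_orthogonal t0 lt); apply: eq_ex => w; rewrite mulrC.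
Qed.

End Harness.

Theorem proposition4p3 (d : measure_display) (T : measurableType d)
    (R : realType) (P : probability T R) (X : R -> {RV P >-> R})
    (q eta theta sigma tau : R)
    (Xsep : separable_process X)
    (Xsq : square_integrable_process X)
    (Xqh : quadratic_harness X q eta theta sigma tau)
    (hpos : 0 < (1 - sigma * tau) ^+ 2
                + (eta + theta * sigma) * (theta + eta * tau))
    (hst : 0 <= sigma * tau < 1)
    (hq : q = - (sigma * tau))
    (Xmom : forall t, 0 < t -> all_moments (X t))
    (Xinf : forall t, 0 < t -> infinite_set (law_support (X t))) :
  exists p : nat -> R -> {poly R},
    orthogonal_martingale_polynomials X p /\
    (forall t, 0 < t ->
      [/\ p 0%N t = 1,
          'X * p 0%N t = p 1%N t,
          'X * p 1%N t =
            (1 + sigma * t) *: p 2%N t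
            + (((eta + theta * sigma) * t + (eta * tau + theta))
               / (1 - sigma * tau)) *: p 1%N t
            + t *: p 0%N t,
          'X * p 2%N t =
            (1 + sigma * t) *: p 3%N t
            + (((eta + 2 * theta * sigma + eta * sigma * tau) * t
                + theta + 2 * eta * tau + theta * sigma * tau)
               / (1 - sigma * tau) ^+ 2) *: p 2%N t
            + (((1 - sigma * tau) ^+ 2
                + (eta + theta * sigma) * (theta + eta * tau))
               / (1 - sigma * tau) ^+ 3 * (t + tau)) *: p 1%N t
        & forall n : nat, (3 <= n)%N ->
          'X * p n t =
            (1 + sigma * t) *: p n.+1 t
            + (((eta + 2 * theta * sigma + eta * sigma * tau) * t
                + theta + 2 * eta * tau + theta * sigma * tau)
               / (1 - sigma * tau) ^+ 2) *: p n t
            + (((1 - sigma * tau) ^+ 2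
                + (eta + theta * sigma) * (theta + eta * tau))
               / (1 - sigma * tau) ^+ 4 * (t + tau)) *: p n.-1 t]).
Proof.
rewrite hq in Xqh; have sigma0 := qh_sigma_ge0 Xqh.
have st1 : 1 - sigma * tau != 0.
  by rewrite gt_eqF// subr_gt0; case/andP: hst.
exists (mart_poly eta theta sigma tau); split;
  first exact: orthogonal_martingale_pol.
move=> t t0; have rec n := mart_poly_rec eta theta tau sigma0 n t0.
split=> [//||||[|[|[|n]]]// _]; first by rewrite pol1 mulr1.
(* The constant terms and slopes in [t] recombine over the common denominators into the stated
   coefficients. *)
all: rewrite [LHS]rec /=; congr (_ + _ *: _ + _ *: _); by field.
Qed.
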